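(* For Case C with $\ell$ particles and partitions $\nu,\mu$ with at most $\ell$ parts, $\mathsf{P}_{\ge,n}(\nu\mid\mu)=\prod_{i=1}^{\ell}\prod_{j=1}^n(1-\pi_ix_j)\,\boldsymbol{\pi}^{\nu/\mu}\det[C_{ij}]_{i,j=1}^{\ell}$, where $C_{1j}=\displaystyle\oint_{\widetilde{\gamma}_r}\frac{1}{(1-\beta_1w^{-1})\prod_{k=1}^{j-1}(1-\beta_kw^{-1})\prod_{m=1}^n(1-x_mw)\,w^{\nu_1-\mu_j-1+j}}\frac{dw}{2\pi\mathbf{i}w}$ and, for $i\ge2$, $C_{ij}=\displaystyle\oint_{\widetilde{\gamma}_r}\frac{\prod_{k=1}^{i-2}(1-\beta_kw^{-1})}{\prod_{k=1}^{j-1}(1-\beta_kw^{-1})\prod_{m=1}^n(1-x_mw)\,w^{\nu_i-\mu_j-i+j}}\frac{dw}{2\pi\mathbf{i}w}$, with $\widetilde{\gamma}_r$ the positively oriented circle centered at $0$ of radius $r$ satisfying $0<r<|x_m^{-1}|$ for $m=1,\dots,n$ and $r>|\beta_1|,|\beta_2|,\dots$.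
   Context: Case C particle system: $\ell$ particles labelled $1,\dots,\ell$ on $\mathbb{Z}_{\ge0}$; $G(j,i)$ is the position of particle $j$ after time step $i$, with $G(1,i)\ge\dots\ge G(\ell,i)\ge0$, so configurations are partitions with at most $\ell$ parts. Parameters $x_1,x_2,\dots$ and $\pi_1,\dots,\pi_\ell$ with $\pi_jx_i\in(0,1)$. At each time step $i$ independent $w_{ji}$ with $\mathsf{P}(w_{ji}=k)=(1-\pi_jx_i)(\pi_jx_i)^k$ ($k\ge0$) are drawn and $G(j,i)=\min(G(j,i-1)+w_{ji},G(j-1,i-1))$ with $G(0,i)=\infty$ (geometric jumps, blocking, updated in order $\ell,\dots,1$). $\mathsf{P}_{\ge,n}(\nu\mid\mu)=\mathsf{P}(G(\ell,n)\ge\nu_\ell,\dots,G(1,n)\ge\nu_1\mid G(\cdot,0)=\mu)$. Notation: $\beta_k=\pi_{k+1}$; $\boldsymbol{\pi}^{\nu/\mu}=\prod_j\pi_j^{\nu_j-\mu_j}$; $\mathbf{i}=\sqrt{-1}$.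
   Formalization: In C_{1j} the extra factor 1/(1-β_1 w^{-1}) is corrected to 1/(1-β_0 w^{-1}) with β_0=π_1 (as printed the identity fails, e.g. for ℓ=n=1, μ=ν=0), and the radius is accordingly required to satisfy r>|π_j| for all j=1,…,ℓ, including π_1. *)

(* Defs.v *)
From HB Require Import structures.
From mathcomp Require Export all_boot all_order all_algebra.
From mathcomp Require Export all_classical all_reals all_analysis.
From mathcomp Require Export complex.

Set Implicit Arguments.
Unset Strict Implicit.
Unset Printing Implicit Defensive.

Import Order.TTheory GRing.Theory Num.Theory.
Import numFieldNormedType.Exports.

Local Open Scope classical_set_scope.
Local Open Scope ring_scope.
Local Open Scope complex_scope.

(* Particle labels, jump times, parameters pi_ and x, and parts of partitions
   are numbered from 1 (G j i is also used at the initial time i = 0); values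
   at an index 0 outside this numbering are never used.                      *)

Definition is_partition (nu : seq nat) : bool :=
  sorted geq nu && (0%N \notin nu).

Definition part (nu : seq nat) (j : nat) : nat := nth 0%N nu j.-1.

Section Probability.
Context (R : realType) (d : measure_display) (T : measurableType d).
Variable P : probability T R.

Definition mutually_independent (I : eqType) (F : I -> set_system T) : Prop :=
  forall (s : seq I) (E : I -> set T), uniq s ->
    (forall a, a \in s -> F a (E a)) ->
    fine (P (\bigcap_(a in [set` s]) E a)) = \prod_(a <- s) fine (P (E a)).

Definition cond_prob (A B : set T) : R := fine (P (A `&` B)) / fine (P B).

Variables (l : nat) (G w : nat -> nat -> T -> nat).

Definition config (i : nat) (t : T) : l.-tuple nat :=
  [tuple G j.+1 i t | j < l].

(* The sigma-algebras of the initial configuration (None) and of each jump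
   w_{ji}, 1 <= j <= l, 1 <= i; both take values in countable discrete sets. *)
Definition noise_events (a : option ('I_l * nat)) : set_system T :=
  if a is Some (j, i)
  then [set w j.+1 i.+1 @^-1` B | B in [set: set nat]]
  else [set config 0 @^-1` B | B in [set: set (l.-tuple nat)]].

Record caseC_system (pi_ x : nat -> R) : Prop := CaseCSystem {
  caseC_init_measurable : forall j, (1 <= j <= l)%N ->
    measurable_fun [set: T] (G j 0);
  caseC_init_ordered : forall j t, (1 <= j < l)%N -> (G j.+1 0 t <= G j 0 t)%N;
  caseC_jump_measurable : forall j i, (1 <= j <= l)%N -> (1 <= i)%N ->
    measurable_fun [set: T] (w j i);
  caseC_jump_geometric : forall j i k, (1 <= j <= l)%N -> (1 <= i)%N ->
    P (w j i @^-1` [set k]) = ((1 - pi_ j * x i) * (pi_ j * x i) ^+ k)%:E;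
  caseC_independent : mutually_independent noise_events;
  (* the convention G(0, i) = +oo: particle 1 is never blocked *)
  caseC_update_first : forall i t, (1 <= l)%N ->
    G 1 i.+1 t = (G 1 i t + w 1 i.+1 t)%N;
  caseC_update : forall j i t, (1 < j <= l)%N ->
    G j i.+1 t = minn (G j i t + w j i.+1 t) (G j.-1 i t)
}.

Definition prob_ge (n : nat) (nu mu : seq nat) : R :=
  cond_prob
    [set t | forall j, (1 <= j <= l)%N -> (part nu j <= G j n t)%N]
    [set t | forall j, (1 <= j <= l)%N -> G j 0 t = part mu j].

End Probability.

Section ContourIntegral.
Variable R : realType.

Definition circle (r theta : R) : R[i] :=
  (r * cos theta) +i* (r * sin theta).

Definition circle' (r theta : R) : R[i] :=
  (- (r * sin theta)) +i* (r * cos theta).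

Definition contour_integral (r : R) (f : R[i] -> R[i]) : R[i] :=
  let g theta := f (circle r theta) * circle' r theta in
  (\int[lebesgue_measure]_(theta in `[0, 2 * pi]) complex.Re (g theta))%R +i*
  (\int[lebesgue_measure]_(theta in `[0, 2 * pi]) complex.Im (g theta))%R.

End ContourIntegral.

Section Determinant.
Variables (R : realType) (pi_ x : nat -> R) (n : nat) (nu mu : seq nat).

Definition beta (k : nat) : R := pi_ k.+1.

Definition pi_skew (l : nat) : R :=
  \prod_(1 <= j < l.+1) pi_ j ^ ((part nu j)%:Z - (part mu j)%:Z).

(* In row 1 the extra factor carries beta_0 = pi_1: it is the k = 0 factor left
   by the empty-range convention prod_{k=1}^{-1} f_k = f_0^{-1} in the formula
   for rows i >= 2. With beta_1 instead the identity fails already for one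
   particle, where P(G(1,1) >= 0 | 0) = 1 would equal
   (1 - pi_1 x_1) / (1 - pi_2 x_1).                                          *)
Definition C_numerator (i : nat) (w : R[i]) : R[i] :=
  if i == 1%N then (1 - (beta 0)%:C * w^-1)^-1
  else \prod_(1 <= k < i.-1) (1 - (beta k)%:C * w^-1).

Definition C_integrand (i j : nat) (w : R[i]) : R[i] :=
  C_numerator i w /
  (\prod_(1 <= k < j) (1 - (beta k)%:C * w^-1) *
   \prod_(1 <= m < n.+1) (1 - (x m)%:C * w) *
   w ^ ((part nu i)%:Z - (part mu j)%:Z - i%:Z + j%:Z)).

Definition C_entry (r : R) (i j : nat) : R[i] :=
  contour_integral r
    (fun w => C_integrand i j w / ((2 * pi)%:C * 'i * w)).

End Determinant.

(* Main.v *)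
Require Import Defs.
From mathcomp Require Import perm ring lra zify.

Set Implicit Arguments.
Unset Strict Implicit.
Unset Printing Implicit Defensive.

Import Order.TTheory GRing.Theory Num.Theory.
Import numFieldNormedType.Exports.

Local Open Scope classical_set_scope.
Local Open Scope ring_scope.
Local Open Scope complex_scope.

(* Blocking acts on thresholds: G(.,n+1) >= nu iff G(j,n) >= nu'_j for all j,
   where nu'_j = max(nu_j - w_j, nu_(j+1)) = nu_j - min(w_j, nu_j - nu_(j+1))
   depends on w_j alone and nu' is again a partition.  Row i of the determinant
   depends only on nu_i, so averaging over the independent w_j acts row by row.
   Writing c_n(k, i, j) for the (i, j) entry with nu_i replaced by k, the
   integrands give
     c_n(k, i) = c_(n+1)(k, i) - x_(n+1) c_(n+1)(k-1, i),
     c_n(k, i+1) = c_n(k-1, i) - pi_i c_n(k, i),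
   and the averaged row i telescopes to row i of the determinant at time n+1
   minus a multiple of its row i+1; for the last row this multiple is of
   c_(n+1)(0, l+1), which vanishes.  At n = 0 the matrix is triangular if
   nu <= mu, and has too large a zero block otherwise.
   All indices are shifted to start from 0 below. *)

(** * Means over a circle of complex functions of the angle *)

Section CircleMean.
Variable R : realType.
Implicit Types (h u : R -> R[i]) (r t c : R) (k : nat).
Local Notation Re := complex.Re.
Local Notation Im := complex.Im.
Local Notation normc := (@ComplexField.Normc.normc R).
Local Notation muR := (@lebesgue_measure R).

Lemma ReB (a b : R[i]) : Re (a - b) = Re a - Re b.
Proof. by case: a b => [? ?] [? ?]. Qed.

Lemma ImB (a b : R[i]) : Im (a - b) = Im a - Im b.
Proof. by case: a b => [? ?] [? ?]. Qed.

Lemma ReZC c (a : R[i]) : Re (c%:C * a) = c * Re a.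
Proof. by case: a => [? ?] /=; rewrite mul0r subr0. Qed.

Lemma ImZC c (a : R[i]) : Im (c%:C * a) = c * Im a.
Proof. by case: a => [? ?] /=; rewrite mul0r addr0. Qed.

Lemma normc_ge0 (a : R[i]) : 0 <= normc a.
Proof. by case: a => x y /=; exact: sqrtr_ge0. Qed.

Lemma normc_eq0 (a : R[i]) : (normc a == 0) = (a == 0).
Proof.
apply/eqP/eqP => [/ComplexField.Normc.eq0_normc //|->].
exact: ComplexField.Normc.normc0.
Qed.

Lemma normc_real c : normc c%:C = `|c|.
Proof. by rewrite /= expr0n /= addr0 sqrtr_sqr. Qed.

Lemma normcX (a : R[i]) k : normc (a ^+ k) = normc a ^+ k.
Proof.
elim: k => [|k IH]; first by rewrite !expr0 ComplexField.Normc.normc1.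
by rewrite !exprS ComplexField.Normc.normcM IH.
Qed.

Lemma le_Re_normc (a : R[i]) : `|Re a| <= normc a.
Proof.
case: a => x y /=; rewrite -sqrtr_sqr ler_sqrt ?addr_ge0 ?sqr_ge0 //.
by rewrite lerDl sqr_ge0.
Qed.

Lemma le_Im_normc (a : R[i]) : `|Im a| <= normc a.
Proof.
case: a => x y /=; rewrite -sqrtr_sqr ler_sqrt ?addr_ge0 ?sqr_ge0 //.
by rewrite lerDr sqr_ge0.
Qed.

Lemma normc_le_ReIm (a : R[i]) : normc a <= `|Re a| + `|Im a|.
Proof.
case: a => x y /=.
rewrite -[leRHS](ger0_norm (addr_ge0 (normr_ge0 x) (normr_ge0 y))) -sqrtr_sqr.
rewrite ler_sqrt ?sqr_ge0 // sqrrD !real_normK ?num_real //.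
have := mulr_ge0 (normr_ge0 x) (normr_ge0 y); lra.
Qed.

Lemma sqr_ReIm_gt0 (a : R[i]) : a != 0 -> 0 < Re a ^+ 2 + Im a ^+ 2.
Proof.
case: a => x y; rewrite eq_complex /= => /nandP a0.
rewrite lt_def paddr_eq0 ?sqr_ge0 // !sqrf_eq0 addr_ge0 ?sqr_ge0 // andbT.
exact/nandP.
Qed.

Lemma subr1_neq0 (a : R[i]) : normc a < 1 -> 1 - a != 0.
Proof.
move=> a1; rewrite subr_eq0; apply: contraTneq a1 => <-.
by rewrite ComplexField.Normc.normc1 ltxx.
Qed.

(** Stated by components because [mean] integrates the real and imaginary parts as real
    functions. *)
Definition ccontinuous h :=
  continuous (fun t => Re (h t)) /\ continuous (fun t => Im (h t)).

Lemma eq_ccontinuous h u : h =1 u -> ccontinuous h -> ccontinuous u.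
Proof. by move=> /funext ->. Qed.

Lemma ccontinuous_cst (a : R[i]) : ccontinuous (fun=> a).
Proof. by split => t; exact: cvg_cst. Qed.

Lemma continuous_realB (f g : R -> R) : continuous f -> continuous g ->
  continuous (fun t => f t - g t).
Proof. by move=> cf cg t; exact: (continuousB (cf t) (cg t)). Qed.

Lemma continuous_realD (f g : R -> R) : continuous f -> continuous g ->
  continuous (fun t => f t + g t).
Proof. by move=> cf cg t; exact: (continuousD (cf t) (cg t)). Qed.

Lemma continuous_realM (f g : R -> R) : continuous f -> continuous g ->
  continuous (fun t => f t * g t).
Proof. by move=> cf cg t; exact: (continuousM (cf t) (cg t)). Qed.

Lemma continuous_realV (f : R -> R) : (forall t, f t != 0) -> continuous f ->
  continuous (fun t => (f t)^-1).
Proof. by move=> f0 cf t; exact: (continuousV (f0 t) (cf t)). Qed.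

Lemma ccontinuousB h u :
  ccontinuous h -> ccontinuous u -> ccontinuous (fun t => h t - u t).
Proof.
move=> [hr hi] [ur ui]; split.
  by under eq_fun do rewrite ReB; exact: continuous_realB.
by under eq_fun do rewrite ImB; exact: continuous_realB.
Qed.

Lemma ccontinuousM h u :
  ccontinuous h -> ccontinuous u -> ccontinuous (fun t => h t * u t).
Proof.
move=> [hr hi] [ur ui].
have E t : h t * u t = (Re (h t) * Re (u t) - Im (h t) * Im (u t)) +i*
    (Re (h t) * Im (u t) + Im (h t) * Re (u t)).
  by case: (h t) (u t) => [? ?] [? ?].
split; under eq_fun do rewrite E /=.
  by apply: continuous_realB; apply: continuous_realM.
by apply: continuous_realD; apply: continuous_realM.
Qed.

Lemma ccontinuousV h : (forall t, h t != 0) -> ccontinuous h ->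
  ccontinuous (fun t => (h t)^-1).
Proof.
move=> h0 [hr hi].
have E t : (h t)^-1 = (Re (h t) * (Re (h t) ^+ 2 + Im (h t) ^+ 2)^-1) +i*
    (0 - Im (h t) * (Re (h t) ^+ 2 + Im (h t) ^+ 2)^-1).
  by rewrite sub0r; case: (h t).
have Cd : continuous (fun t => Re (h t) ^+ 2 + Im (h t) ^+ 2).
  by apply: continuous_realD; apply: continuous_realM.
have Cn : continuous (fun t => (Re (h t) ^+ 2 + Im (h t) ^+ 2)^-1).
  have d0 t : Re (h t) ^+ 2 + Im (h t) ^+ 2 != 0.
    by rewrite gt_eqF // sqr_ReIm_gt0.
  exact: continuous_realV.
split; under eq_fun do rewrite E /=; first exact: continuous_realM.
by apply: continuous_realB; [move=> ?; exact: cvg_cst|exact: continuous_realM].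
Qed.

Lemma ccontinuous_prod (I : Type) (s : seq I) (F : I -> R -> R[i]) :
  (forall i, ccontinuous (F i)) -> ccontinuous (fun t => \prod_(i <- s) F i t).
Proof.
move=> cF; elim: s => [|i s IH].
  by apply: eq_ccontinuous (ccontinuous_cst 1) => t; rewrite big_nil.
by apply: eq_ccontinuous (ccontinuousM (cF i) IH) => t; rewrite big_cons.
Qed.

Lemma ccontinuousX h k : ccontinuous h -> ccontinuous (fun t => h t ^+ k).
Proof.
move=> ch; elim: k => [|k IH].
  by apply: eq_ccontinuous (ccontinuous_cst 1) => t; rewrite expr0.
by apply: eq_ccontinuous (ccontinuousM ch IH) => t; rewrite exprS.
Qed.

Lemma ccontinuousXz h (z : int) : (forall t, h t != 0) -> ccontinuous h ->
  ccontinuous (fun t => h t ^ z).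
Proof.
move=> h0 ch; case: z => k; first exact: ccontinuousX.
by apply: ccontinuousV; [move=> t; rewrite expf_neq0|exact: ccontinuousX].
Qed.

Lemma ccontinuous_circle r : ccontinuous (circle r).
Proof.
split; apply: continuous_realM; try by move=> ?; exact: cvg_cst.
  exact: continuous_cos.
exact: continuous_sin.
Qed.

Lemma integrable_continuous (f : R -> R) : continuous f ->
  muR.-integrable `[0, 2 * pi] (EFin \o f).
Proof.
move=> cf; apply: continuous_compact_integrable; first exact: segment_compact.
exact: continuous_subspaceT.
Qed.

(** On a centred circle dw / (2 pi i w) is dt / (2 pi), so the contour integrals of the theorem
    become such averages over the angle. *)
Definition mean h : R[i] :=
  ((\int[muR]_(t in `[0, (2 * pi)%R]) Re (h t)) / (2 * pi))%R +i*
  ((\int[muR]_(t in `[0, (2 * pi)%R]) Im (h t)) / (2 * pi))%R.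

Lemma eq_mean h u : h =1 u -> mean h = mean u.
Proof. by move=> /funext ->. Qed.

(** The recurrences for the entries and the step of [mean_pow_div_eq0] all have this shape, with a
    real coefficient. *)
Lemma meanBZ h u c : ccontinuous h -> ccontinuous u ->
  mean (fun t => h t - c%:C * u t) = mean h - c%:C * mean u.
Proof.
move=> [hr hi] [ur ui].
have L (f g : R -> R) : continuous f -> continuous g ->
    (\int[muR]_(t in `[0%R, (2 * pi)%R]) (f t - c * g t) =
    \int[muR]_(t in `[0%R, (2 * pi)%R]) f t -
    c * \int[muR]_(t in `[0%R, (2 * pi)%R]) g t)%R.
  move=> cf cg; rewrite RintegralB //; last 2 first.
  - exact: integrable_continuous.
  - apply: integrable_continuous.
    by apply: continuous_realM => // t; exact: cvg_cst.
  by rewrite RintegralZl //; exact: integrable_continuous.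
apply/eqP; rewrite eq_complex ReB ReZC ImB ImZC /=; apply/andP; split.
  under eq_Rintegral do rewrite ReB ReZC.
  by rewrite L // mulrBl mulrA.
under eq_Rintegral do rewrite ImB ImZC.
by rewrite L // mulrBl mulrA.
Qed.

Lemma lebesgue_measure_circle : muR `[0%R, (2 * pi)%R] = (2 * pi)%:E.
Proof.
have pi0 := pi_gt0 R.
apply: (eq_trans (lebesgue_measure_itv _)); rewrite /= lte_fin.
by rewrite ifT ?oppr0 ?addr0 //; lra.
Qed.

Lemma Rintegral_circle_cst c :
  (\int[muR]_(t in `[0%R, (2 * pi)%R]) c)%R = c * (2 * pi).
Proof.
rewrite Rintegral_cst //; congr (_ * _).
exact: (congr1 (@fine R) lebesgue_measure_circle).
Qed.

(** Each component is at most [c] in absolute value, whence the factor 2; its size is harmless,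
    since the bound serves only in a limit. *)
Lemma normc_mean_le h c : ccontinuous h ->
  (forall t, t \in `[0, 2 * pi] -> normc (h t) <= c) ->
  normc (mean h) <= c *+ 2.
Proof.
move=> [hr hi] hc; have pi0 := pi_gt0 R.
have L (f : R -> R) : continuous f ->
    (forall t, t \in `[0, 2 * pi] -> `|f t| <= c) ->
    `|((\int[muR]_(t in `[0%R, (2 * pi)%R]) f t) / (2 * pi))%R| <= c.
  move=> cf fc; rewrite normrM normfV (@ger0_norm _ (2 * pi)); last by lra.
  rewrite ler_pdivrMr; last by lra.
  apply: (le_trans (le_normr_Rintegral _ (integrable_continuous cf))) => //.
  rewrite -Rintegral_circle_cst.
  apply: le_Rintegral => //.
  - apply: integrable_continuous => t.
    by apply: continuous_comp; [exact: cf|exact: norm_continuous].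
  - by apply: integrable_continuous => t; exact: cvg_cst.
apply: (le_trans (normc_le_ReIm _)); rewrite mulr2n lerD //.
  by apply: L => // t /hc; exact: le_trans (le_Re_normc _).
by apply: L => // t /hc; exact: le_trans (le_Im_normc _).
Qed.

Lemma ccontinuous_bounded h : ccontinuous h ->
  exists2 c, 0 <= c & forall t, t \in `[0, 2 * pi] -> normc (h t) <= c.
Proof.
move=> [hr hi]; have pi0 := pi_gt0 R.
have cn : continuous (fun t => `|Re (h t)| + `|Im (h t)|).
  apply: continuous_realD => t; apply: continuous_comp;
    by [exact: hr|exact: hi|exact: norm_continuous].
have [|a _ ha] := @EVT_max _ _ 0 (2 * pi) _ (continuous_subspaceT cn).
  by lra.
exists (`|Re (h a)| + `|Im (h a)|); first by rewrite addr_ge0.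
by move=> t /ha; apply: le_trans; exact: normc_le_ReIm.
Qed.

(* With J k the mean of u^k h / (1 - c u), the hypothesis gives J k = c J (k+1);
   iterating, J k = c^N J (k+N) is O((c rho)^N). *)
Lemma mean_pow_div_eq0 h u c rho :
  ccontinuous h -> ccontinuous u -> (forall t, normc (u t) = rho) ->
  `|c| * rho < 1 ->
  (forall k, mean (fun t => u t ^+ k.+1 * h t) = 0) ->
  forall k, mean (fun t => u t ^+ k.+1 * (h t / (1 - c%:C * u t))) = 0.
Proof.
move=> ch cu nu crho h0 k.
have rho0 : 0 <= rho by rewrite -(nu 0) normc_ge0.
have d0 t : 1 - c%:C * u t != 0.
  apply: subr1_neq0.
  by rewrite ComplexField.Normc.normcM nu normc_real.
have cd : ccontinuous (fun t => h t / (1 - c%:C * u t)).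
  apply: ccontinuousM => //; apply: ccontinuousV => //.
  apply: ccontinuousB; first exact: ccontinuous_cst.
  by apply: ccontinuousM => //; exact: ccontinuous_cst.
pose J k := mean (fun t => u t ^+ k.+1 * (h t / (1 - c%:C * u t))).
have cJ m : ccontinuous (fun t => u t ^+ m.+1 * (h t / (1 - c%:C * u t))).
  by apply: ccontinuousM => //; exact: ccontinuousX.
have JS m : J m = c%:C * J m.+1.
  apply/eqP; rewrite -subr_eq0 -meanBZ //; apply/eqP.
  rewrite -[RHS](h0 m); apply: eq_mean => t.
  by have := d0 t => dt; rewrite [u t ^+ m.+2]exprSr; field.
have JN N : J k = c%:C ^+ N * J (k + N)%N.
  elim: N => [|N ->]; first by rewrite expr0 mul1r addn0.
  by rewrite JS addnS exprSr mulrA.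
have [B B0 hB] := ccontinuous_bounded cd.
have le0 N : normc (J k) <= (rho ^+ k.+1 * B *+ 2) * (`|c| * rho) ^+ N.
  rewrite (JN N) ComplexField.Normc.normcM normcX normc_real exprMn.
  have -> : rho ^+ k.+1 * B *+ 2 * (`|c| ^+ N * rho ^+ N) =
      `|c| ^+ N * (rho ^+ (k + N).+1 * B *+ 2).
    by rewrite -addSn exprD; ring.
  rewrite ler_wpM2l ?exprn_ge0 //; apply: normc_mean_le => // t /hB hBt.
  by rewrite ComplexField.Normc.normcM normcX nu ler_wpM2l ?exprn_ge0.
have lim0 : (rho ^+ k.+1 * B *+ 2) * (`|c| * rho) ^+ N @[N --> \oo] --> (0 : R).
  rewrite -[X in _ --> X](mulr0 (rho ^+ k.+1 * B *+ 2)).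
  by apply: cvgMl_tmp; apply: cvg_expr; rewrite ger0_norm // mulr_ge0.
apply/eqP; rewrite -normc_eq0 eq_le normc_ge0 andbT.
by apply: (cvgr_to_ge lim0); apply: nearW.
Qed.

(** Fundamental theorem of calculus in each component: the antiderivatives return to their initial
    values after one turn. *)
Lemma mean_derive_eq0 (F G f g : R -> R) :
  (forall t, is_derive t 1 F (f t)) -> (forall t, is_derive t 1 G (g t)) ->
  continuous f -> continuous g ->
  F (2 * pi) = F 0 -> G (2 * pi) = G 0 ->
  mean (fun t => f t +i* g t) = 0.
Proof.
have pi0 := pi_gt0 R.
have L (A a : R -> R) : (forall t, is_derive t 1 A (a t)) -> continuous a ->
    A (2 * pi) = A 0 -> (\int[muR]_(t in `[0%R, (2 * pi)%R]) a t)%R = 0.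
  move=> dA ca A0; rewrite /Rintegral.
  have cA : continuous A.
    move=> t; apply/differentiable_continuous/derivable1_diffP.
    exact: (@ex_derive _ _ _ _ _ _ _ (dA t)).
  rewrite (@continuous_FTC2 _ a A) ?A0 ?subrr //=.
  - by rewrite subrr.
  - by lra.
  - exact: continuous_subspaceT.
  - split => [t _| |].
    + exact: (@ex_derive _ _ _ _ _ _ _ (dA t)).
    + exact/cvg_at_right_filter/cA.
    + exact/cvg_at_left_filter/cA.
  - by move=> t _; rewrite derive1E (@derive_val _ _ _ _ _ _ _ (dA t)).
by move=> dF dG cf cg F0 G0; rewrite /mean /= (L F f) // (L G g) // mul0r.
Qed.

(** The integrand is rho e^(i a t), with antiderivative (rho / a) (sin (a t) - i cos (a t)). Both
    signs of [a] occur, for positive and negative powers of w. *)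
Lemma mean_circle_eq0 (rho a : R) : a != 0 ->
  sin (a * (2 * pi)) = 0 -> cos (a * (2 * pi)) = 1 ->
  mean (fun t => circle rho (a * t)) = 0.
Proof.
move=> a0 s0 c1.
have da t : is_derive t 1 (fun t => a * t) a.
  by apply: is_derive_eq; rewrite [LHS]mulr1.
have cta : continuous (fun t => a * t).
  by apply: continuous_realM => t; [exact: cvg_cst|exact: cvg_id].
have ccos : continuous (fun t => cos (a * t)).
  by move=> t; apply: continuous_comp; [exact: cta|exact: continuous_cos].
have csin : continuous (fun t => sin (a * t)).
  by move=> t; apply: continuous_comp; [exact: cta|exact: continuous_sin].
apply: (@mean_derive_eq0 (fun t => rho / a * sin (a * t))
                         (fun t => - (rho / a) * cos (a * t))) => [t|t|||/=|/=].
- have ds := is_derive1_comp (is_derive_sin (a * t)) (da t).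
  apply: (is_derive_eq (is_deriveZ (rho / a) ds)).
  by rewrite /GRing.scale /=; field.
- have ds := is_derive1_comp (is_derive_cos (a * t)) (da t).
  apply: (is_derive_eq (is_deriveZ (- (rho / a)) ds)).
  by rewrite /GRing.scale /=; field.
- by apply: continuous_realM => // t; exact: cvg_cst.
- by apply: continuous_realM => // t; exact: cvg_cst.
- by rewrite s0 [a * 0]mulr0 sin0.
- by rewrite c1 [a * 0]mulr0 cos0.
Qed.

(** De Moivre's formula: powers of w become higher frequencies, as [mean_circle_eq0] expects. *)
Lemma circleX r t k : circle r t ^+ k = circle (r ^+ k) (k%:R * t).
Proof.
elim: k => [|k IH].
  by rewrite !expr0 mul0r /circle cos0 sin0 mulr1 mulr0.
rewrite exprS IH -natr1 mulrDl mul1r /circle cosD sinD exprS.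
by apply/eqP; rewrite eq_complex /=; apply/andP; split; apply/eqP; ring.
Qed.

Lemma circleV r t : r != 0 -> (circle r t)^-1 = circle r^-1 (- t).
Proof.
move=> r0; have cs := cos2Dsin2 t.
have E : circle r t * circle r^-1 (- t) = 1.
  rewrite /circle cosN sinN; apply/eqP; rewrite eq_complex /=.
  apply/andP; split; apply/eqP; last by ring.
  by rewrite -cs; field.
have c0 : circle r t != 0.
  by apply: contra_eqN E => /eqP ->; rewrite mul0r eq_sym oner_eq0.
by apply: (mulfI c0); rewrite E divff.
Qed.

Lemma normc_circle r t : 0 <= r -> normc (circle r t) = r.
Proof.
move=> r0; rewrite /circle /= !exprMn -mulrDr cos2Dsin2 mulr1 sqrtr_sqr.
exact: ger0_norm.
Qed.

Lemma circle_neq0 r t : 0 < r -> circle r t != 0.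
Proof. by move=> r0; rewrite -normc_eq0 normc_circle ?gt_eqF // ltW. Qed.

Lemma sincos_2piMn k :
  sin (k%:R * (2 * pi) : R) = 0 /\ cos (k%:R * (2 * pi) : R) = 1.
Proof.
have E : k%:R * (2 * pi) = 0 + pi *+ 2 *+ k :> R.
  by rewrite add0r -[RHS]mulr_natl -[pi *+ 2]mulr_natl.
rewrite E (periodicn (@sinD2pi R)) (periodicn (@cosD2pi R)).
by rewrite sin0 cos0.
Qed.

Lemma mean_circleX r k : mean (fun t => circle r t ^+ k.+1) = 0.
Proof.
under eq_fun do rewrite circleX.
have [s0 c1] := sincos_2piMn k.+1.
by apply: mean_circle_eq0; rewrite // pnatr_eq0.
Qed.

Lemma mean_circleVX r k : 0 < r -> mean (fun t => (circle r t)^-1 ^+ k.+1) = 0.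
Proof.
move=> r0; have [s0 c1] := sincos_2piMn k.+1.
under eq_fun do rewrite circleV ?gt_eqF // circleX mulrN -mulNr.
apply: mean_circle_eq0; first by rewrite oppr_eq0 pnatr_eq0.
  by rewrite mulNr sinN s0 oppr0.
by rewrite mulNr cosN.
Qed.

Lemma mean1 : mean (fun=> 1) = 1.
Proof.
have pi0 := pi_gt0 R.
by rewrite /mean /= !Rintegral_circle_cst !mul0r mul1r divff // gt_eqF //; lra.
Qed.

End CircleMean.

(** * Matrix entries as circle means: recurrences and vanishing *)

Section Entries.
Variables (R : realType) (r : R) (p x : nat -> R) (mu : nat -> nat) (l N : nat).
Hypotheses (r_gt0 : 0 < r) (p_lt : forall a, (a < l)%N -> `|p a| < r).
Hypothesis x_lt : forall m, (m < N)%N -> `|x m| * r < 1.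
Implicit Types (t : R) (e k : int).
Local Notation normc := (@ComplexField.Normc.normc R).

Definition pfac a t : R[i] := 1 - (p a)%:C * (circle r t)^-1.
Definition xfac m t : R[i] := 1 - (x m)%:C * circle r t.

(** The p-factor of index 0 is put into both numerator and denominator of every row [i > 0]. This
    makes row 0, where only the denominator has it, an instance of the same formula. *)
Definition entry_fun n i j e t : R[i] :=
  circle r t ^ (- e) * \prod_(a < i) pfac a t /
  (\prod_(a < j.+1) pfac a t * \prod_(m < n) xfac m t).

(** [k] stands for the part nu_i; it is an integer because the recurrences can lower it below 0. *)
Definition entry n k i j : R[i] :=
  mean (entry_fun n i j (k - (mu j)%:Z - i%:Z + j%:Z)).

Lemma ccontinuous_pfac a : ccontinuous (pfac a).
Proof.
apply: ccontinuousB; first exact: ccontinuous_cst.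
apply: ccontinuousM; first exact: ccontinuous_cst.
by apply: ccontinuousV (ccontinuous_circle _) => t; exact: circle_neq0.
Qed.

Lemma ccontinuous_xfac m : ccontinuous (xfac m).
Proof.
apply: ccontinuousB; first exact: ccontinuous_cst.
by apply: ccontinuousM (ccontinuous_circle _); exact: ccontinuous_cst.
Qed.

Lemma pV_lt a : (a < l)%N -> `|p a| * r^-1 < 1.
Proof. by move=> /p_lt pa; rewrite ltr_pdivrMr // mul1r. Qed.

Lemma normc_circleV t : normc (circle r t)^-1 = r^-1.
Proof. by rewrite ComplexField.Normc.normcV normc_circle // ltW. Qed.

Lemma pfac_neq0 a t : (a < l)%N -> pfac a t != 0.
Proof.
move=> al; apply: subr1_neq0.
by rewrite ComplexField.Normc.normcM normc_real normc_circleV pV_lt.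
Qed.

Lemma xfac_neq0 m t : (m < N)%N -> xfac m t != 0.
Proof.
move=> mN; apply: subr1_neq0.
by rewrite ComplexField.Normc.normcM normc_real normc_circle ?ltW ?x_lt.
Qed.

Lemma prod_pfac_neq0 j t : (j <= l)%N -> \prod_(a < j) pfac a t != 0.
Proof.
move=> jl; apply/prodf_neq0 => a _; apply: pfac_neq0.
exact: leq_trans (ltn_ord a) jl.
Qed.

Lemma prod_xfac_neq0 n t : (n <= N)%N -> \prod_(m < n) xfac m t != 0.
Proof.
move=> nN; apply/prodf_neq0 => m _; apply: xfac_neq0.
exact: leq_trans (ltn_ord m) nN.
Qed.

Lemma ccontinuous_entry_fun n i j e : (n <= N)%N -> (j < l)%N ->
  ccontinuous (entry_fun n i j e).
Proof.
move=> nN jl; have cc := ccontinuous_circle r; apply: ccontinuousM.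
  apply: ccontinuousM.
    by apply: ccontinuousXz => // t; exact: circle_neq0.
  by apply: ccontinuous_prod => a; exact: ccontinuous_pfac.
apply: ccontinuousV => [t|].
  by rewrite mulf_neq0 ?prod_pfac_neq0 ?prod_xfac_neq0.
apply: ccontinuousM; apply: ccontinuous_prod => a.
  exact: ccontinuous_pfac.
exact: ccontinuous_xfac.
Qed.

Lemma circle_exprB t e :
  circle r t ^ (- (e - 1)) = circle r t ^ (- e) * circle r t.
Proof. by rewrite opprB addrC exprzDr ?unitfE ?circle_neq0 // expr1z. Qed.

(** Write the inverse product of x-factors as (1 - x_n w) over the product one factor longer; a
    factor w lowers the exponent, hence [k], by 1. *)
Lemma entry_time n k i j : (n < N)%N -> (j < l)%N ->
  entry n k i j = entry n.+1 k i j - (x n)%:C * entry n.+1 (k - 1) i j.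
Proof.
move=> nN jl; rewrite /entry -meanBZ; last 2 first.
- exact: ccontinuous_entry_fun.
- exact: ccontinuous_entry_fun.
apply: eq_mean => t; rewrite /entry_fun.
have -> : k - 1 - (mu j)%:Z - i%:Z + j%:Z = k - (mu j)%:Z - i%:Z + j%:Z - 1.
  by ring.
rewrite circle_exprB [\prod_(m < n.+1) _]big_ord_recr /=.
set A := \prod_(a < i) _; set B := \prod_(a < j.+1) _; set D := \prod_(m < n) _.
have B0 : B != 0 by exact: prod_pfac_neq0.
have D0 : D != 0 by apply: prod_xfac_neq0; exact: ltnW.
have := xfac_neq0 t nN; rewrite /xfac => x0.
by field; rewrite B0 D0 x0.
Qed.

(** Passing to row i+1 multiplies the integrand by w (1 - p_i / w) = w - p_i, and a factor w amounts
    to lowering [k] by 1. *)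
Lemma entry_row n k i j : (n <= N)%N -> (j < l)%N ->
  entry n k i.+1 j = entry n (k - 1) i j - (p i)%:C * entry n k i j.
Proof.
move=> nN jl; rewrite /entry -meanBZ; last 2 first.
- exact: ccontinuous_entry_fun.
- exact: ccontinuous_entry_fun.
apply: eq_mean => t; rewrite /entry_fun.
have -> : k - 1 - (mu j)%:Z - i%:Z + j%:Z = k - (mu j)%:Z - i%:Z + j%:Z - 1.
  by ring.
have -> : k - (mu j)%:Z - i.+1%:Z + j%:Z = k - (mu j)%:Z - i%:Z + j%:Z - 1.
  by lia.
rewrite circle_exprB [\prod_(a < i.+1) _]big_ord_recr /=.
set A := \prod_(a < i) _; set B := \prod_(a < j.+1) _; set D := \prod_(m < n) _.
have B0 : B != 0 by exact: prod_pfac_neq0.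
have D0 : D != 0 by exact: prod_xfac_neq0.
have c0 := circle_neq0 t r_gt0.
by rewrite /pfac; field; rewrite B0 D0 c0.
Qed.

(** The integrand is analytic in the closed disc and vanishes at 0. The x-factors are inserted one
    at a time by [mean_pow_div_eq0], starting from a pure power of w. *)
Lemma mean_circleX_xfac n (k : nat) : (n <= N)%N ->
  mean (fun t => circle r t ^+ k.+1 * (\prod_(m < n) xfac m t)^-1) = 0.
Proof.
elim: n k => [|n IH] k nN.
  rewrite -[RHS](mean_circleX r k); apply: eq_mean => t.
  by rewrite big_ord0 invr1 mulr1.
under eq_fun do rewrite big_ord_recr /= invfM.
apply: (@mean_pow_div_eq0 _ (fun t => (\prod_(m < n) xfac m t)^-1) _ (x n) r).
- apply: ccontinuousV => [t|]; first by rewrite (prod_xfac_neq0 _ (ltnW nN)).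
  by apply: ccontinuous_prod => a; exact: ccontinuous_xfac.
- exact: ccontinuous_circle.
- by move=> t; rewrite normc_circle ?ltW.
- exact: x_lt.
- by move=> m; rewrite IH // ltnW.
Qed.

(** In row j+1 the numerator cancels all p-factors of column j, leaving a positive power of w over
    the x-factors. *)
Lemma entry_below_diag n k j : (n <= N)%N -> (j < l)%N -> k <= (mu j)%:Z ->
  entry n k j.+1 j = 0.
Proof.
move=> nN jl kmu.
rewrite -[RHS](@mean_circleX_xfac n `|(mu j)%:Z - k|%N) //.
apply: eq_mean => t; rewrite /entry_fun invfM mulrA mulfK ?prod_pfac_neq0 //.
congr (_ * _).
have -> : - (k - (mu j)%:Z - j.+1%:Z + j%:Z) = (`|(mu j)%:Z - k|%N.+1)%:Z by lia.
by [].
Qed.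

(** The p-factors cancel and the exponent is 0, so the integrand is 1; this seeds the diagonal in
    [c_diag]. *)
Lemma entry_sub_diag1 j : (j < l)%N -> entry 0 (mu j).+1%:Z j.+1 j = 1.
Proof.
move=> jl; rewrite -[RHS](mean1 R); apply: eq_mean => t.
rewrite /entry_fun big_ord0 mulr1 mulfK ?prod_pfac_neq0 //.
have -> : (mu j).+1%:Z - (mu j)%:Z - j.+1%:Z + j%:Z = 0 by lia.
by rewrite oppr0 expr0z.
Qed.

(** Mirror image of [mean_circleX_xfac] under w -> 1/w: the integrand is analytic outside the circle
    and vanishes at infinity. *)
Lemma mean_circleV_pfac j (k : nat) : (j <= l)%N ->
  mean (fun t => (circle r t)^-1 ^+ k.+1 * (\prod_(a < j) pfac a t)^-1) = 0.
Proof.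
elim: j k => [|j IH] k jl.
  rewrite -[RHS](mean_circleVX k r_gt0); apply: eq_mean => t.
  by rewrite big_ord0 invr1 mulr1.
under eq_fun do rewrite big_ord_recr /= invfM.
apply: (@mean_pow_div_eq0 _ (fun t => (\prod_(a < j) pfac a t)^-1)
  (fun t => (circle r t)^-1) (p j) r^-1).
- apply: ccontinuousV => [t|]; first by rewrite (prod_pfac_neq0 _ (ltnW jl)).
  by apply: ccontinuous_prod => a; exact: ccontinuous_pfac.
- by apply: ccontinuousV (ccontinuous_circle _) => t; exact: circle_neq0.
- by move=> t; rewrite normc_circleV.
- exact: pV_lt.
- by move=> m; rewrite IH // ltnW.
Qed.

(** Row 0 has an empty numerator, and at time 0 only a negative power of w over the p-factors
    remains. *)
Lemma entry_first_row k j : (j < l)%N -> 0 < k - (mu j)%:Z + j%:Z ->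
  entry 0 k 0 j = 0.
Proof.
move=> jl k0.
rewrite -[RHS](@mean_circleV_pfac j.+1 (absz (k - (mu j)%:Z + j%:Z - 1)%R)) //.
apply: eq_mean => t; rewrite /entry_fun !big_ord0 !mulr1; congr (_ / _).
have -> : - (k - (mu j)%:Z - 0%:Z + j%:Z) =
  - ((absz (k - (mu j)%:Z + j%:Z - 1)%R).+1%:Z) by lia.
by rewrite exprVn -exprnN.
Qed.

End Entries.

(** * Determinants: expansion by rows and zero blocks *)

Section DetRows.
Variables (F : fieldType) (l : nat).

Lemma det_scale_rows (g : 'I_l -> F) (A : 'I_l -> 'I_l -> F) :
  \det (\matrix_(i, j) (g i * A i j)) =
  (\prod_i g i) * \det (\matrix_(i, j) A i j).
Proof.
rewrite mulr_sumr; apply: eq_bigr => s _.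
rewrite mulrCA -big_split /=; congr (_ * _).
by apply: eq_bigr => i _; rewrite !mxE.
Qed.

(** Each product over rows in the Leibniz formula is distributed into a sum over choice functions.
    In the application [a i] is the truncated jump of particle [i]. *)
Lemma det_sum_rows (J : finType) (f : 'I_l -> J -> 'I_l -> F) :
  \det (\matrix_(i, j) \sum_b f i b j) =
  \sum_(a : {ffun 'I_l -> J}) \det (\matrix_(i, j) f i (a i) j).
Proof.
rewrite exchange_big /=; apply: eq_bigr => s _; rewrite -mulr_sumr.
congr (_ * _); under eq_bigr do rewrite mxE.
rewrite bigA_distr_bigA /=; apply: eq_bigr => a _.
by apply: eq_bigr => i _; rewrite mxE.
Qed.

(* A zero block of size (m + 1) x (l - m) leaves no transversal. *)
Lemma det_zero_block (A : 'M[F]_l) (m : 'I_l) :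
  (forall i j : 'I_l, (i <= m)%N -> (m <= j)%N -> A i j = 0) -> \det A = 0.
Proof.
move=> A0; rewrite /determinant big1 // => s _.
have [i im mi] : exists2 i : 'I_l, (i <= m)%N & (m <= s i)%N.
  apply/exists_inP; apply: contraT; rewrite negb_exists_in => /forall_inP smi.
  have sm (i : 'I_m.+1) : (s (widen_ord (ltn_ord m) i) < m)%N.
    by rewrite ltnNge smi //= -ltnS.
  have : injective (fun i => Ordinal (sm i)).
    move=> i i' [] /val_inj/perm_inj/(congr1 val) /= ii'; exact: val_inj.
  by move=> /leq_card; rewrite !card_ord ltnn.
by rewrite (bigD1 i) //= A0 // mul0r mulr0.
Qed.

End DetRows.

(** [a] is extended by 0 beyond the [l] labels, so the new thresholds are again a sequence over all
    naturals and agree with [nu] from [l] on. *)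
Definition drop_parts l K (nu : nat -> nat) (a : {ffun 'I_l -> 'I_K}) (i : nat) :=
  (nu i - (if insub i is Some i' then a i' : nat else 0))%N.

Lemma drop_partsE l K (nu : nat -> nat) (a : {ffun 'I_l -> 'I_K}) (i : 'I_l) :
  drop_parts nu a i = (nu i - a i)%N.
Proof. by rewrite /drop_parts valK. Qed.

(** * Time recursion of the weighted determinant *)

Section DetRecursion.
Variables (F : fieldType) (p x : nat -> F) (mu : nat -> nat) (l N : nat).
Variable c : nat -> int -> nat -> nat -> F.
Hypothesis mu_noninc : forall i j, (i <= j)%N -> (mu j <= mu i)%N.
Hypothesis p_neq0 : forall i, (i < l)%N -> p i != 0.
Hypothesis q_neq1 : forall i m, (i < l)%N -> (m < N)%N -> 1 - p i * x m != 0.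
Hypothesis c_time : forall n k i j, (n < N)%N -> (j < l)%N ->
  c n k i j = c n.+1 k i j - x n * c n.+1 (k - 1) i j.
Hypothesis c_row : forall n k i j, (n <= N)%N -> (j < l)%N ->
  c n k i.+1 j = c n (k - 1) i j - p i * c n k i j.
Hypothesis c_below : forall n k j, (n <= N)%N -> (j < l)%N -> k <= (mu j)%:Z ->
  c n k j.+1 j = 0.
Hypothesis c_sub1 : forall j, (j < l)%N -> c 0 (mu j).+1%:Z j.+1 j = 1.
Hypothesis c_first : forall k j, (j < l)%N -> 0 < k - (mu j)%:Z + j%:Z ->
  c 0 k 0 j = 0.

(** Descend from the subdiagonal: [c_row] expresses a row through the one above it at [k - 1] and
    [k], and both stay at most [mu j]. *)
Lemma c_lower n k i j : (n <= N)%N -> (j < l)%N -> (j < i)%N ->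
  k <= (mu j)%:Z -> c n k i j = 0.
Proof.
move=> nN jl; elim: i k => // i IH k.
rewrite ltnS leq_eqVlt => /orP[/eqP <-|ji] kmu.
  exact: c_below.
by rewrite c_row // !IH ?mulr0 ?subr0 //; lia.
Qed.

(** Induction from row 0: the exponent k - mu_j - i + j is kept in one term of [c_row] and raised by
    1 in the other. *)
Lemma c_upper k i j : (j < l)%N -> (i <= j)%N ->
  0 < k - (mu j)%:Z - i%:Z + j%:Z -> c 0 k i j = 0.
Proof.
move=> jl; elim: i k => [|i IH] k ij k0; first by apply: c_first => //; lia.
by rewrite c_row // !IH ?mulr0 ?subr0 //; lia.
Qed.

(** By [c_row] in row [j], lowering [k] by 1 multiplies the diagonal entry by [p j] whenever the
    subdiagonal entry vanishes, which holds for k at most mu_j. At k = mu_j + 1 the subdiagonal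
    entry is 1 and the diagonal one is 0, which starts the induction. *)
Lemma c_diag j (q : nat) : (j < l)%N -> c 0 ((mu j)%:Z - q%:Z) j j = p j ^+ q.
Proof.
move=> jl; elim: q => [|q IH].
  have := c_row (mu j).+1%:Z j (leq0n N) jl.
  rewrite c_sub1 // [c 0 (mu j).+1%:Z j j]c_upper ?mulr0 ?subr0 //; last by lia.
  by rewrite expr0 => ->; congr c; lia.
have := c_row ((mu j)%:Z - q%:Z) j (leq0n N) jl.
rewrite c_below //; last by lia.
move/esym/eqP; rewrite subr_eq0 IH exprS => /eqP <-.
by congr c; lia.
Qed.

(** The right-hand side of the theorem, with prefactors grouped by rows and the skew power written
    with natural exponents. *)
Definition det_weight n (nu : nat -> nat) : F :=
  (\prod_(i < l) (\prod_(m < n) (1 - p i * x m) * (p i ^+ nu i / p i ^+ mu i)))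
  * \det (\matrix_(i < l, j < l) c n (nu i)%:Z i j).

Lemma det_weight0 (nu : nat -> nat) :
  (forall i j, (i <= j)%N -> (nu j <= nu i)%N) ->
  det_weight 0 nu = [forall i : 'I_l, nu i <= mu i]%N%:R.
Proof.
move=> nu_noninc; rewrite /det_weight.
have [/forallP numu|] := boolP [forall i : 'I_l, (nu i <= mu i)%N]; last first.
  rewrite negb_forall => /existsP[m]; rewrite -ltnNge => mum.
  (* For i <= m <= j one has nu_i >= nu_m > mu_m >= mu_j, so [c_upper] kills this block. *)
  rewrite (det_zero_block (m := m)) ?mulr0 // => i j im mj; rewrite mxE.
  have := nu_noninc _ _ im; have := mu_noninc mj => ? ?.
  by apply: c_upper => //; lia.
rewrite -det_tr det_trig; last first.
  apply/is_trig_mxP => j i ji; rewrite !mxE; apply: c_lower => //.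
  by have := nu_noninc _ _ (ltnW ji); have := numu j; lia.
rewrite -big_split /= big1 // => i _; rewrite !mxE big_ord0 mul1r.
have -> : (nu i)%:Z = (mu i)%:Z - (mu i - nu i)%N%:Z by have := numu i; lia.
(* The diagonal entry is p_i^(mu_i - nu_i), which cancels the prefactor. *)
rewrite c_diag // mulrAC -exprD subnKC ?numu // divff // expf_neq0 //.
exact: p_neq0.
Qed.

(* The law of min(w, m) for w geometric of parameter q. *)
Definition trunc_geom (q : F) (m a : nat) : F :=
  if (a < m)%N then (1 - q) * q ^+ a else if a == m then q ^+ m else 0.

(** [K] is any bound beyond the support: terms with a > m carry no mass. *)
Lemma sum_trunc_geom q m K (f : nat -> F) : (m < K)%N ->
  \sum_(a < K) trunc_geom q m a * f a =
  \sum_(a < m) (1 - q) * q ^+ a * f a + q ^+ m * f m.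
Proof.
move=> mK; rewrite -(big_mkord xpredT (fun a => trunc_geom q m a * f a)).
rewrite (big_cat_nat _ (n := m.+1)) //= big_nat_recr //= [X in _ + X]big_nat_cond.
rewrite [X in _ + X]big1 ?addr0; last first.
  move=> a /andP[/andP[ma _] _]; rewrite /trunc_geom ltnNge ltnW //=.
  by rewrite gtn_eqF // mul0r.
rewrite /trunc_geom ltnn eqxx big_mkord; congr (_ + _).
by apply: eq_bigr => a _; rewrite ltn_ord.
Qed.

(** Induction on [m]. For [m = 0] combine [c_time] with [c_row]. In the step, the terms after the
    first are [p i * x n] times the sum for [m], and the main term this produces cancels against the
    x-part of [c_time] in the first term. In use [k] is nu_(i+1) and [k + m] is nu_i. *)
Lemma row_step n i j k m : (n < N)%N -> (j < l)%N ->
  \sum_(a < m) (1 - p i * x n) * (p i * x n) ^+ a *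
     (p i ^+ (k + m - a) * c n (k + m - a)%N%:Z i j) +
  (p i * x n) ^+ m * (p i ^+ k * c n k%:Z i j) =
  (1 - p i * x n) * p i ^+ (k + m) * c n.+1 (k + m)%N%:Z i j -
  x n * (p i * x n) ^+ m * p i ^+ k * c n.+1 k%:Z i.+1 j.
Proof.
move=> nN jl; elim: m => [|m IH].
  rewrite big_ord0 add0r addn0 (c_time k) // c_row // expr0; ring.
rewrite big_ord_recl /= expr0 subn0 (c_time _ i nN jl).
have -> : (k + m.+1)%N%:Z - 1 = (k + m)%N%:Z by lia.
have -> : \sum_(a < m) (1 - p i * x n) * (p i * x n) ^+ bump 0 a *
     (p i ^+ (k + m.+1 - bump 0 a) * c n (k + m.+1 - bump 0 a)%N%:Z i j) =
   (p i * x n) * \sum_(a < m) (1 - p i * x n) * (p i * x n) ^+ a *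
     (p i ^+ (k + m - a) * c n (k + m - a)%N%:Z i j).
  rewrite mulr_sumr; apply: eq_bigr => a _; rewrite /bump /= add1n addnS subSS.
  by rewrite exprS; ring.
by rewrite (canRL (addrK _) IH) addnS !exprS; ring.
Qed.

(** The determinant of the row-averaged matrix [E] is computed twice: by multilinearity it is a sum
    over jumps, by row operations it is, up to prefactors, the determinant at time n+1. *)
Lemma det_weight_rec n (nu : nat -> nat) K : (n < N)%N ->
  (forall i j, (i <= j)%N -> (nu j <= nu i)%N) -> nu l = 0%N ->
  (forall i, (i < l)%N -> (nu i < K)%N) ->
  det_weight n.+1 nu =
  \sum_(a : {ffun 'I_l -> 'I_K})
    (\prod_(i < l) trunc_geom (p i * x n) (nu i - nu i.+1) (a i)) *
    det_weight n (drop_parts nu a).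
Proof.
move=> nN nu_noninc nul nuK.
pose q i := p i * x n.
pose m i := (nu i - nu i.+1)%N.
pose E : 'M[F]_l := \matrix_(i, j) \sum_(a < K)
  trunc_geom (q i) (m i) a * (p i ^+ (nu i - a) * c n (nu i - a)%N%:Z i j).
pose M : 'M[F]_l := \matrix_(i, j)
  ((1 - q i) * p i ^+ nu i * c n.+1 (nu i)%:Z i j).
(* [L] subtracts from each row a multiple of the next one, as [row_step] demands; the divisor undoes
   the scaling of row i+1 in [M]. *)
pose L : 'M[F]_l := \matrix_(i, j) ((i == j)%:R - (j == i.+1 :> nat)%:R *
  (x n * q i ^+ m i * p i ^+ nu i.+1 / ((1 - q i.+1) * p i.+1 ^+ nu i.+1))).
have EM : E = L *m M.
  apply/matrixP => i j; rewrite !mxE.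
  have nui := nu_noninc _ _ (leqnSn i).
  have miK : (m i < K)%N by apply: leq_ltn_trans (nuK i _); rewrite ?leq_subr.
  rewrite (sum_trunc_geom (q i)
    (fun a => p i ^+ (nu i - a) * c n (nu i - a)%N%:Z i j) miK).
  have nuE : nu i = (nu i.+1 + m i)%N by rewrite /m subnKC.
  rewrite (_ : (nu i - m i)%N = nu i.+1); last by rewrite {1}nuE addnK.
  have := row_step i (nu i.+1) (m i) nN (ltn_ord j).
  rewrite -!nuE => ->.
  have -> : \sum_(k < l) L i k * M k j = M i j - \sum_(k < l)
      (k == i.+1 :> nat)%:R * (x n * q i ^+ m i * p i ^+ nu i.+1 /
        ((1 - q i.+1) * p i.+1 ^+ nu i.+1)) * M k j.
    under eq_bigr do rewrite mxE mulrBl.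
    rewrite sumrB (bigD1 i) //= eqxx mul1r [X in _ + X - _]big1 ?addr0 //.
    by move=> k ki; rewrite eq_sym (negPf ki) mul0r.
  rewrite mxE; congr (_ - _).
  have [il|li] := ltnP i.+1 l.
    rewrite (bigD1 (Ordinal il)) //= eqxx mul1r big1 ?addr0 => [|k ki].
      rewrite mxE /= /q; field.
      by rewrite expf_neq0 ?p_neq0 // q_neq1.
    by rewrite (_ : (_ == _) = false) ?mul0r //; apply/negbTE.
  (* The last row has no successor: the extra term is c_(n+1)(0, l, j), zero by [c_lower]. *)
  have il : i.+1 = l by apply/eqP; rewrite eqn_leq li ltn_ord.
  rewrite il c_lower ?mulr0 ?nul // big1 // => k _.
  by rewrite ltn_eqF ?mul0r.
have detE : \det E = (\prod_(i < l) ((1 - q i) * p i ^+ nu i)) *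
    \det (\matrix_(i < l, j < l) c n.+1 (nu i)%:Z i j).
  rewrite EM det_mulmx -det_scale_rows -[\det L]det_tr det_trig; last first.
    apply/is_trig_mxP => j i ji; rewrite !mxE.
    by rewrite -val_eqE (gtn_eqF ji) (ltn_eqF (leqW ji)) mul0r subr0.
  rewrite big1 ?mul1r // => i _.
  by rewrite !mxE eqxx ltn_eqF // mul0r subr0.
have detE' : \det E = \sum_(a : {ffun 'I_l -> 'I_K})
    (\prod_(i < l) (trunc_geom (q i) (m i) (a i) * p i ^+ (nu i - a i))) *
    \det (\matrix_(i < l, j < l) c n (drop_parts nu a i)%:Z i j).
  rewrite /E det_sum_rows; apply: eq_bigr => a _.
  rewrite -det_scale_rows; congr (\det _); apply/matrixP => i j.
  by rewrite !mxE drop_partsE mulrA.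
(* [Z] collects the prefactors shared by times n and n+1; [detE] and [detE'] hold the others. *)
pose Z := \prod_(i < l) (\prod_(k < n) (1 - p i * x k) / p i ^+ mu i).
transitivity (Z * \det E).
  rewrite detE /det_weight mulrA -big_split /=; congr (_ * _).
  by apply: eq_bigr => i _; rewrite big_ord_recr /= /q; ring.
rewrite detE' mulr_sumr; apply: eq_bigr => a _.
rewrite /det_weight !mulrA -!big_split /=; congr (_ * _).
by apply: eq_bigr => i _; rewrite drop_partsE /q /m; ring.
Qed.

End DetRecursion.

(** * Finite additivity of probability *)

Section FiniteAdditivity.
Context (R : realType) (d : measure_display) (T : measurableType d).
Variable P : probability T R.

(** Measurability of [A] is concluded as well: events about later configurations get theirs from
    such partitions. *)
Lemma prob_finite_partition (J : finType) (A : set T) (B : J -> set T) :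
  (forall t, A t <-> exists j, B j t) ->
  (forall i j t, B i t -> B j t -> i = j) ->
  (forall j, measurable (B j)) ->
  measurable A /\ fine (P A) = \sum_j fine (P (B j)).
Proof.
move=> AB Bdisj mB.
have -> : A = \bigcup_(j in [set: J]) B j.
  apply/seteqP; split=> t; first by move=> /AB[j Bj]; exists j.
  by move=> [j _ Bj]; apply/AB; exists j.
split; first by apply: fin_bigcup_measurable => //; exact: finite_finset.
rewrite measure_fin_bigcup //; last 2 first.
- exact: finite_finset.
- by move=> i j _ _ [t [Bi Bj]]; exact: Bdisj Bi Bj.
have -> : [set: J] = [set` index_enum J].
  by apply/seteqP; split=> j //= _; rewrite mem_index_enum.
rewrite -fsbig_seq ?index_enum_uniq // sum_fine // => j _.
exact: fin_num_measure.
Qed.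

Lemma fine_prob_setT : fine (P setT) = 1.
Proof. by rewrite probability_setT. Qed.

Lemma fine_probU (A B : set T) : measurable A -> measurable B ->
  A `&` B = set0 -> fine (P (A `|` B)) = fine (P A) + fine (P B).
Proof.
move=> mA mB AB0; rewrite measureU // fineD //; exact: fin_num_measure.
Qed.

End FiniteAdditivity.

(** * The particle system: one time step and joint laws *)

Section Particles.
Context (R : realType) (d : measure_display) (T : measurableType d).
Variables (P : probability T R) (l : nat) (pi_ x : nat -> R).
Variables (G w : nat -> nat -> T -> nat).
Hypothesis hsys : caseC_system P l G w pi_ x.
Let p i := pi_ i.+1.
Let X m := x m.+1.

(** Label and time are shifted by 1 as in [noise_events], which makes these the events of the
    independence hypothesis. *)
Definition jump_event (a : 'I_l * nat) (B : set nat) : set T :=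
  w a.1.+1 a.2.+1 @^-1` B.

Lemma measurable_jump_event a B : measurable (jump_event a B).
Proof.
have := caseC_jump_measurable hsys (ltn_ord a.1 : (1 <= a.1.+1 <= l)%N) (ltn0Sn a.2).
by move=> /(_ measurableT B); rewrite setTI; apply.
Qed.

(** Removing the mass at [m] from the tail leaves q^m - (1 - q) q^m = q^(m+1). *)
Lemma prob_jump_ge (a : 'I_l * nat) m :
  fine (P (jump_event a [set k | (m <= k)%N])) = (p a.1 * X a.2) ^+ m.
Proof.
elim: m => [|m IH].
  rewrite expr0 -(fine_prob_setT P); congr (fine (P _)).
  by apply/seteqP; split.
have E : jump_event a [set k | (m <= k)%N] =
    jump_event a [set m] `|` jump_event a [set k | (m < k)%N].
  apply/seteqP; split=> t; rewrite /jump_event /=.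
    by rewrite leq_eqVlt => /orP[/eqP<-|]; [left|right].
  by move=> [->|/ltnW].
move: IH; rewrite E fine_probU; last 3 first.
- exact: measurable_jump_event.
- exact: measurable_jump_event.
- by apply/seteqP; split=> t //; rewrite /jump_event /= => -[->]; rewrite ltnn.
rewrite /jump_event (caseC_jump_geometric hsys) //= => /(canRL (addKr _)) ->.
by rewrite exprS /p /X; ring.
Qed.

(** Below [m] this is the geometric mass, at [m] the whole tail, above [m] nothing. *)
Lemma prob_jump_trunc (a : 'I_l * nat) m b :
  fine (P (jump_event a [set k | minn k m = b])) =
  trunc_geom (p a.1 * X a.2) m b.
Proof.
rewrite /trunc_geom; have [bm|mb] := ltnP b m.
  rewrite (_ : [set k | _] = [set b]); last by apply/seteqP; split=> k /=; lia.
  by rewrite /jump_event (caseC_jump_geometric hsys) /=.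
have [->|bm] := eqVneq b m.
  rewrite -prob_jump_ge; congr (fine (P (jump_event _ _))).
  by apply/seteqP; split=> k /=; lia.
rewrite (_ : [set k | _] = set0) ?/jump_event ?preimage_set0 ?measure0 //.
by apply/seteqP; split=> k //=; move/eqP: bm; lia.
Qed.

Definition init_event (mu : nat -> nat) : set T :=
  [set t | forall j, (1 <= j <= l)%N -> G j 0 t = mu j.-1].

Definition ge_event n (nu : nat -> nat) : set T :=
  [set t | forall j : 'I_l, (nu j <= G j.+1 n t)%N].

Definition jumps_event (s : seq ('I_l * nat)) (E : 'I_l * nat -> set nat) : set T :=
  [set t | forall a, a \in s -> E a (w a.1.+1 a.2.+1 t)].

(** Exhibits the event as generated by [config 0], the form in which independence speaks of it. *)
Lemma init_eventE mu : init_event mu =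
  config l G 0 @^-1` [set [tuple mu j | j < l]].
Proof.
apply/seteqP; split=> t /= H.
  by apply/eq_from_tnth => j; rewrite !tnth_mktuple H /=.
move=> [//|j] /= jl; have := congr1 (fun u => tnth u (Ordinal jl)) H.
by rewrite !tnth_mktuple.
Qed.

Lemma measurable_init_event mu : measurable (init_event mu).
Proof.
rewrite (_ : init_event mu =
  \bigcap_(j in [set: 'I_l]) (G j.+1 0 @^-1` [set mu j])).
  apply: fin_bigcap_measurable; first exact: finite_finset.
  move=> j _; have := caseC_init_measurable hsys (ltn_ord j : (1 <= j.+1 <= l)%N).
  by move=> /(_ measurableT [set mu j]); rewrite setTI; apply.
apply/seteqP; split=> t H; first by move=> j _ /=; apply: H => /=.
by move=> [//|j] /= jl; exact: (H (Ordinal jl)).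
Qed.

Lemma measurable_jumps_event s E : measurable (jumps_event s E).
Proof.
rewrite (_ : jumps_event s E = \bigcap_(a in [set` s]) jump_event a (E a)).
  apply: fin_bigcap_measurable; first exact: finite_seq.
  by move=> a _; exact: measurable_jump_event.
by apply/seteqP; split=> t H a; exact: H.
Qed.

(** Independence for the list made of [None], the initial configuration, followed by the jumps in
    [s]. *)
Lemma prob_init_jumps mu s E : uniq s ->
  fine (P (init_event mu `&` jumps_event s E)) =
  fine (P (init_event mu)) * \prod_(a <- s) fine (P (jump_event a (E a))).
Proof.
move=> us.
pose F (a : option ('I_l * nat)) :=
  if a is Some b then jump_event b (E b) else init_event mu.
have := @caseC_independent _ _ _ _ _ _ _ _ _ hsys (None :: map Some s) F.
rewrite /= map_inj_uniq ?us; last by move=> ? ? [].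
rewrite andbT big_cons big_map /= => <-.
- congr (fine (P _)); apply/seteqP; split=> t /=.
    move=> [It Jt] [a|] /=; last by [].
    by rewrite inE /= mem_map => [/Jt|? ? []].
  move=> H; split; first by apply: (H None); rewrite /= inE.
  by move=> a sa; apply: (H (Some a)); rewrite /= inE /= map_f.
- by apply/mapP => -[].
- move=> [[j i]|] _ /=; first by exists (E (j, i)).
  by exists [set [tuple mu j | j < l]]; rewrite ?init_eventE.
Qed.

(** By the update rule G(j, n+1) >= nu_j asks for G(j, n) + w_j >= nu_j and G(j-1, n) >= nu_j.
    Collecting what bears on the same G(j, n) gives the lower bounds nu_j - w_j and nu_(j+1); for
    the last particle [nu l = 0] makes the second one vacuous. *)
Lemma ge_event_step n (nu : nat -> nat) t :
  (forall i j, (i <= j)%N -> (nu j <= nu i)%N) -> nu l = 0%N ->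
  ge_event n.+1 nu t <-> forall j : 'I_l,
    (nu j - minn (w j.+1 n.+1 t) (nu j - nu j.+1) <= G j.+1 n t)%N.
Proof.
move=> nu_noninc nul; split=> H j.
  have le1 : (nu j <= G j.+1 n t + w j.+1 n.+1 t)%N.
    apply: leq_trans (H j) _; case: (nat_of_ord j) (ltn_ord j) => [|i] il.
      by rewrite (caseC_update_first hsys).
    by rewrite (caseC_update hsys) // geq_minl.
  have le2 : (nu j.+1 <= G j.+1 n t)%N.
    have [jl|lj] := ltnP j.+1 l.
      apply: leq_trans (H (Ordinal jl)) _.
      by rewrite /= (caseC_update hsys) //= geq_minr.
    by rewrite (_ : j.+1 = l) ?nul //; apply/eqP; rewrite eqn_leq lj ltn_ord.
  by have := nu_noninc _ _ (leqnSn j); lia.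
have Hj := H j; case: j Hj => -[|i] il /= Hj.
  by rewrite (caseC_update_first hsys) //; lia.
rewrite (caseC_update hsys) //= leq_min; apply/andP; split; first by lia.
have := H (Ordinal (ltnW il)); have := nu_noninc _ _ (leqnSn i); rewrite /=; lia.
Qed.

Lemma trunc_geom_real (q : R) m b : (trunc_geom q m b)%:C = trunc_geom q%:C m b.
Proof.
rewrite /trunc_geom; case: ifP => _; last by case: ifP => _; rewrite ?rmorphXn.
by rewrite rmorphM rmorphB rmorph1 rmorphXn.
Qed.

(** The lowered parts interlace with the old ones: nu'_j <= nu_j <= nu_(i+1) <= nu'_i for i < j. *)
Lemma drop_parts_noninc K (nu : nat -> nat) (a : {ffun 'I_l -> 'I_K}) :
  (forall i j, (i <= j)%N -> (nu j <= nu i)%N) -> nu l = 0%N ->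
  (forall j : 'I_l, (a j <= nu j - nu j.+1)%N) ->
  forall i j, (i <= j)%N -> (drop_parts nu a j <= drop_parts nu a i)%N.
Proof.
move=> nu_noninc nul am i j; rewrite leq_eqVlt => /orP[/eqP -> //|ij].
apply: (@leq_trans (nu j)); first exact: leq_subr.
have [il|li] := ltnP i l; last first.
  by rewrite (leq_trans (nu_noninc _ _ (leq_trans li (ltnW ij)))) // nul.
rewrite (drop_partsE nu a (Ordinal il)) /=.
by have := nu_noninc _ _ ij; have := nu_noninc _ _ (leqnSn i);
  have := am (Ordinal il); rewrite /=; lia.
Qed.

(** For the induction the event is intersected with conditions on jumps after time n: splitting by
    the jumps of step n+1 adds them to the list [s], and independence is spent at n = 0.
    Measurability is carried along for finite additivity. *)
Lemma prob_ge_event_jumps (mu : nat -> nat) (N : nat)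
    (W : nat -> (nat -> nat) -> R[i]) :
  (forall nu : nat -> nat, (forall i j, (i <= j)%N -> (nu j <= nu i)%N) ->
    W 0%N nu = [forall i : 'I_l, nu i <= mu i]%N%:R) ->
  (forall n (nu : nat -> nat) K, (n < N)%N ->
    (forall i j, (i <= j)%N -> (nu j <= nu i)%N) -> nu l = 0%N ->
    (forall i, (i < l)%N -> (nu i < K)%N) ->
    W n.+1 nu = \sum_(a : {ffun 'I_l -> 'I_K})
      (\prod_(i < l) trunc_geom ((p i)%:C * (X n)%:C) (nu i - nu i.+1) (a i)) *
      W n (drop_parts nu a)) ->
  forall n (nu : nat -> nat) s E, (n <= N)%N ->
    (forall i j, (i <= j)%N -> (nu j <= nu i)%N) -> nu l = 0%N ->
    uniq s -> (forall b, b \in s -> (n <= b.2)%N) ->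
  measurable (init_event mu `&` ge_event n nu `&` jumps_event s E) /\
  (fine (P (init_event mu `&` ge_event n nu `&` jumps_event s E)))%:C =
  (fine (P (init_event mu)) *
   \prod_(b <- s) fine (P (jump_event b (E b))))%:C * W n nu.
Proof.
move=> W0 WS; elim=> [|n IH] nu s E nN nu_noninc nul us sn.
  rewrite W0 //.
  have [/forallP numu|] := boolP [forall i : 'I_l, (nu i <= mu i)%N].
    rewrite (_ : init_event mu `&` _ = init_event mu); last first.
      apply/seteqP; split=> t; first by case.
      by move=> It; split=> // j; rewrite It /=.
    rewrite mulr1 prob_init_jumps //; split=> //; apply: measurableI.
      exact: measurable_init_event.
    exact: measurable_jumps_event.
  rewrite negb_forall => /existsP[m numu].
  rewrite (_ : init_event mu `&` _ = set0).
    by rewrite set0I measure0 mulr0; split.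
  apply/seteqP; split=> t // -[It Gt].
  by move: numu; rewrite -(It m.+1) //= => /negP; apply; exact: Gt.
pose m j := (nu j - nu j.+1)%N.
(* [nu 0] is the largest part, so all truncated jumps lie in ['I_K]. *)
pose K := (nu 0%N).+1.
pose s' := [seq (j, n) | j <- enum 'I_l].
(* Jumps of step n+1 get their truncated value prescribed by [a]; later ones keep their
   condition. *)
pose E' (a : {ffun 'I_l -> 'I_K}) (b : 'I_l * nat) :=
  if b.2 == n then [set k | minn k (m b.1) = a b.1] else E b.
pose B a := init_event mu `&` ge_event n (drop_parts nu a) `&`
  jumps_event (s' ++ s) (E' a).
have s'P j : (j, n) \in s' by apply/mapP; exists j => //; rewrite mem_enum.
have BP a t : B a t -> forall j : 'I_l, minn (w j.+1 n.+1 t) (m j) = a j.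
  move=> [_ Jt] j; have := Jt (j, n); rewrite mem_cat s'P /E' /= eqxx.
  exact.
have s_neq b : b \in s -> (b.2 == n) = false.
  by move=> /sn nb; rewrite gtn_eqF.
have AB t : (init_event mu `&` ge_event n.+1 nu `&` jumps_event s E) t <->
    exists a, B a t.
  split=> [[[It Gt] Jt]|[a Bt]].
    have mK j : (minn (w j.+1 n.+1 t) (m j) < K)%N.
      rewrite ltnS (leq_trans (geq_minr _ _)) //.
      by rewrite (leq_trans (leq_subr _ _)) ?nu_noninc.
    exists [ffun j : 'I_l => Ordinal (mK j)]; split; first split=> //.
      move=> j; rewrite drop_partsE ffunE /=.
      by move/(ge_event_step _ _ nu_noninc nul): Gt; apply.
    move=> b; rewrite mem_cat /E'; case: eqP => [bn _|bn].
      by rewrite /= ffunE /= bn.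
    by move=> /orP[/mapP[j _ bE]|/Jt //]; rewrite bE in bn.
  have aE := BP _ _ Bt; case: Bt => [[It Gt] Jt]; split; first split=> //.
    apply/(ge_event_step _ _ nu_noninc nul) => j.
    by have := Gt j; rewrite drop_partsE -aE.
  move=> b sb; have := Jt b; rewrite mem_cat sb orbT /E' s_neq //.
  exact.
have Bdisj a a' t : B a t -> B a' t -> a = a'.
  move=> /BP aE /BP aE'; apply/ffunP => j; apply: val_inj.
  by rewrite /= -aE -aE'.
have us' : uniq (s' ++ s).
  rewrite cat_uniq us map_inj_uniq ?enum_uniq ?andbT //=; last by move=> ? ? [].
  apply/hasPn => b /s_neq bn; apply/mapP => -[j _ bE].
  by rewrite bE /= eqxx in bn.
have s'n b : b \in s' ++ s -> (n <= b.2)%N.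
  by rewrite mem_cat => /orP[/mapP[j _ ->]//|/sn/ltnW].
have BE a : measurable (B a) /\ (fine (P (B a)))%:C =
    (fine (P (init_event mu)) * \prod_(b <- s) fine (P (jump_event b (E b))))%:C *
    ((\prod_(i < l) trunc_geom ((p i)%:C * (X n)%:C) (nu i - nu i.+1) (a i)) *
      W n (drop_parts nu a)).
  (* When every [a j] is at most [m j] the induction hypothesis applies to [drop_parts nu a];
     otherwise the event is empty and [trunc_geom] vanishes at some [j]. *)
  have [/forallP am|] := boolP [forall j : 'I_l, (a j <= m j)%N].
    have dn := drop_parts_noninc nu_noninc nul am.
    have dl : drop_parts nu a l = 0%N by rewrite /drop_parts nul sub0n.
    have [mB ->] := IH (drop_parts nu a) (s' ++ s) (E' a) (ltnW nN) dn dl us' s'n.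
    split=> //; rewrite mulrA.
    congr (_ * _); rewrite big_cat big_map big_enum /= !rmorphM /=.
    rewrite -!mulrA; congr (_ * _); rewrite mulrC; congr (_ * _).
      rewrite !rmorph_prod; apply: eq_big_seq => b sb.
      by rewrite /E' s_neq.
    rewrite rmorph_prod; apply: eq_bigr => j _.
    by rewrite /E' /= eqxx prob_jump_trunc /= trunc_geom_real rmorphM.
  rewrite negb_forall => /existsP[j]; rewrite -ltnNge => maj.
  have -> : B a = set0.
    by apply/seteqP; split=> t // /BP/(_ j); move: maj; lia.
  split=> //; rewrite measure0 (bigD1 j) //= /trunc_geom ltnNge (ltnW maj) /=.
  by rewrite gtn_eqF // !mul0r mulr0.
have [mA ->] := prob_finite_partition P AB Bdisj (fun a => (BE a).1).
split=> //; rewrite (WS n nu K) //; last by move=> i il; rewrite ltnS nu_noninc.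
by rewrite rmorph_sum mulr_sumr; apply: eq_bigr => a _; exact: (BE a).2.
Qed.

End Particles.

(** * From contour integrals to circle means *)

Section Translation.
Variables (R : realType) (pi_ x : nat -> R) (n : nat) (nu mu : seq nat) (r : R).
Variable l : nat.
Hypotheses (r_gt0 : 0 < r) (beta_lt : forall k, (k < l)%N -> `|beta pi_ k| < r).
Hypothesis x_lt : forall m, (m < n)%N -> `|x m.+1| * r < 1.

Lemma C_integrandE i j t : (j < l)%N ->
  C_integrand pi_ x n nu mu i.+1 j.+1 (circle r t) =
  entry_fun r (beta pi_) (fun m => x m.+1) n i j
    ((part nu i.+1)%:Z - (part mu j.+1)%:Z - i%:Z + j%:Z) t.
Proof.
move=> jl; rewrite /C_integrand /entry_fun.
have -> : (part nu i.+1)%:Z - (part mu j.+1)%:Z - i.+1%:Z + j.+1%:Z =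
          (part nu i.+1)%:Z - (part mu j.+1)%:Z - i%:Z + j%:Z by lia.
set e := _ + j%:Z; rewrite -invr_expz.
have p0 : pfac r (beta pi_) 0 t != 0.
  by apply: (pfac_neq0 r_gt0 beta_lt); exact: leq_ltn_trans (leq0n j) jl.
have pfacE k : \prod_(a < k.+1) pfac r (beta pi_) a t =
    pfac r (beta pi_) 0 t *
    \prod_(1 <= a < k.+1) (1 - (beta pi_ a)%:C * (circle r t)^-1).
  by rewrite -(big_mkord xpredT (fun a => pfac r (beta pi_) a t)) big_ltn.
have xfacE : \prod_(1 <= m < n.+1) (1 - (x m)%:C * circle r t) =
    \prod_(m < n) xfac r (fun m => x m.+1) m t.
  by rewrite big_add1 big_mkord.
rewrite pfacE xfacE !invfM.
case: i @e => [|i] e; rewrite /C_numerator /=.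
  (* In row 1 the numerator supplies the index 0 factor of the denominator. *)
  by rewrite big_ord0 -/(pfac r (beta pi_) 0 t); ring.
rewrite pfacE; set A := \prod_(1 <= k < i.+1) _.
set q := pfac r (beta pi_) 0 t.
(* In the other rows the index 0 factor [q] stands above and below in [entry_fun], and in neither
   place in [C_integrand]. *)
transitivity (q / q * (A * ((\prod_(1 <= k < j.+1)
  (1 - (beta pi_ k)%:C * (circle r t)^-1))^-1 *
  (\prod_(m < n) xfac r (fun m => x m.+1) m t)^-1 * (circle r t ^ e)^-1))).
  by rewrite divff // mul1r.
ring.
Qed.

Lemma C_entryE i j : (j < l)%N ->
  C_entry pi_ x n nu mu r i.+1 j.+1 =
  entry r (beta pi_) (fun m => x m.+1) (fun k => part mu k.+1) n
    (part nu i.+1)%:Z i j.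
Proof.
move=> jl; rewrite /C_entry /entry.
set e := _ + j%:Z; set h := entry_fun _ _ _ _ _ _ e.
have [hr hi] : ccontinuous h.
  exact: (@ccontinuous_entry_fun _ _ _ (fun m => x m.+1) l n).
have pi0 : 2 * pi != 0 :> R by rewrite mulf_neq0 // gt_eqF // pi_gt0.
have gE t : C_integrand pi_ x n nu mu i.+1 j.+1 (circle r t) /
    ((2 * pi)%:C * 'i * circle r t) * circle' r t = ((2 * pi)^-1)%:C * h t.
  rewrite C_integrandE // -/e -/h fmorphV /=.
  (* On the circle dw = i w dt, which cancels i w in the denominator and leaves 1 / (2 pi). *)
  have -> : circle' r t = 'i * circle r t.
    by rewrite /circle' /circle; apply/eqP; rewrite eq_complex /=;
      apply/andP; split; apply/eqP; ring.
  have c0 := circle_neq0 t r_gt0.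
  have i0 : 'i != 0 :> R[i] by rewrite eq_complex /= oner_eq0 andbF.
  have piC : (2 * pi)%:C != 0 :> R[i] by rewrite fmorph_eq0.
  move: (real_complex _ (2 * pi)) piC => q q0.
  by field; rewrite c0 i0 q0.
rewrite /contour_integral /mean; congr (_ +i* _).
  under eq_Rintegral do rewrite gE ReZC.
  by rewrite RintegralZl //; [exact: mulrC|exact: integrable_continuous].
under eq_Rintegral do rewrite gE ImZC.
by rewrite RintegralZl //; [exact: mulrC|exact: integrable_continuous].
Qed.

End Translation.

(** * The formula for the conditional probability *)

Lemma is_partition_noninc (nu : seq nat) : is_partition nu ->
  forall i j, (i <= j)%N -> (part nu j.+1 <= part nu i.+1)%N.
Proof.
move=> /andP[snu _] i j ij; rewrite /part /=.
have [jn|nj] := ltnP j (size nu); last by rewrite nth_default.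
apply: (sorted_leq_nth (rev_trans leq_trans) leqnn 0%N snu) => //.
by rewrite inE (leq_ltn_trans ij).
Qed.

Theorem theorem6p9 (R : realType) (d : measure_display) (T : measurableType d)
    (P : probability T R) (l : nat) (pi_ x : nat -> R)
    (G w : nat -> nat -> T -> nat)
    (hpix : forall j i, (1 <= j <= l)%N -> (1 <= i)%N -> 0 < pi_ j * x i < 1)
    (hsys : caseC_system P l G w pi_ x)
    (n : nat) (nu mu : seq nat)
    (hnu : is_partition nu) (hnul : (size nu <= l)%N)
    (hmu : is_partition mu) (hmul : (size mu <= l)%N)
    (hG0 : (0 < P [set t | forall j, (1 <= j <= l)%N ->
                             G j 0%N t = part mu j])%E)
    (r : R) (hr : 0 < r)
    (hrx : forall m, (1 <= m <= n)%N -> r < `|(x m)^-1|)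
    (hrbeta : forall k, (k < l)%N -> `|beta pi_ k| < r) :
  (prob_ge P l G n nu mu)%:C =
    (\prod_(1 <= i < l.+1) \prod_(1 <= j < n.+1) (1 - pi_ i * x j)
       * pi_skew pi_ nu mu l)%:C
    * \det (\matrix_(i < l, j < l) C_entry pi_ x n nu mu r i.+1 j.+1).
Proof.
have nu_noninc := is_partition_noninc hnu.
have mu_noninc := is_partition_noninc hmu.
have nul : part nu l.+1 = 0%N by rewrite /part nth_default.
have x_lt m : (m < n)%N -> `|x m.+1| * r < 1.
  move=> mn; have := hrx m.+1 mn; rewrite normfV => rx.
  (* Since the inverse of 0 is 0 here, [rx] rules out a zero parameter. *)
  have x0 : 0 < `|x m.+1|.
    rewrite lt_def normr_ge0 andbT; apply: contraTneq rx => ->.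
    by rewrite invr0 -leNgt ltW.
  by rewrite mulrC -ltr_pdivlMr // div1r.
pose p i : R[i] := (beta pi_ i)%:C.
pose X m : R[i] := (x m.+1)%:C.
pose mu' k := part mu k.+1.
pose c := entry r (beta pi_) (fun m => x m.+1) mu'.
have c_row := @entry_row R r _ (fun m => x m.+1) mu' l n hr hrbeta x_lt.
have c_below := @entry_below_diag R r _ (fun m => x m.+1) mu' l n hr hrbeta x_lt.
have p0 i : (i < l)%N -> p i != 0.
  move=> il; have /andP[+ _] := hpix i.+1 1%N il isT.
  rewrite fmorph_eq0; apply: contraTneq.
  by rewrite /beta => ->; rewrite mul0r ltxx.
have q1 i m : (i < l)%N -> (m < n)%N -> 1 - p i * X m != 0.
  move=> il mn; have /andP[_ lt1] := hpix i.+1 m.+1 il isT.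
  rewrite /p /X -rmorphM -[1](rmorph1 (real_complex R)) -rmorphB fmorph_eq0.
  by rewrite subr_eq0 gt_eqF.
pose W := det_weight p X mu' l c.
have W0 := det_weight0 X mu_noninc p0 c_row c_below
  (entry_sub_diag1 _ _ hr hrbeta) (entry_first_row _ hr hrbeta) : forall nu', _ ->
  W 0%N nu' = _.
have WS := det_weight_rec p0 q1
  (@entry_time R r _ (fun m => x m.+1) mu' l n hr hrbeta x_lt) c_row c_below :
  forall n' nu' K, _ -> _ -> _ -> _ -> W n'.+1 nu' = _.
(* With no later jumps listed, [jumps_event] is the whole space. *)
have no_jump (b : 'I_l * nat) : b \in [::] -> (n <= b.2)%N by [].
have [_] := prob_ge_event_jumps hsys (mu := mu') (W := W) W0 WS (fun=> set0)
  (leqnn n) (nu := fun i => part nu i.+1) (s := [::]) nu_noninc nul isT no_jump.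
rewrite big_nil mulr1.
rewrite (_ : jumps_event _ _ _ = setT) ?setIT => [PE|]; last first.
  by apply/seteqP; split.
rewrite /prob_ge /cond_prob.
have -> : [set t | forall j, (1 <= j <= l)%N -> (part nu j <= G j n t)%N] =
    ge_event l G n (fun i => part nu i.+1).
  apply/seteqP; split=> t H; first by move=> j; exact: (H j.+1 (ltn_ord j)).
  by move=> [//|j] /= jl; exact: (H (Ordinal jl)).
rewrite -[[set t | _]]/(init_event l G mu') setIC rmorphM fmorphV /= PE.
(* By [hG0] the conditioning event has nonzero probability, which therefore cancels in the
   quotient. *)
have I0 : (fine (P (init_event l G mu')))%:C != 0.
  rewrite fmorph_eq0 gt_eqF // fine_gt0 // hG0 /=.
  by rewrite ltey_eq fin_num_measure //; exact: measurable_init_event hsys _.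
rewrite mulrAC mulfV // mul1r /W /det_weight; congr (_ * _); last first.
  congr (\det _); apply/matrixP => i j; rewrite !mxE.
  by rewrite (C_entryE _ _ hr hrbeta x_lt).
rewrite /pi_skew !big_add1 !big_mkord -big_split /= rmorph_prod.
apply: eq_bigr => i _; rewrite big_add1 big_mkord rmorphM; congr (_ * _).
  rewrite rmorph_prod; apply: eq_bigr => m _.
  by rewrite rmorphB rmorph1 rmorphM.
have pi0 : pi_ i.+1 != 0 by have := p0 i (ltn_ord i); rewrite fmorph_eq0.
by rewrite expfzDr // -invr_expz rmorphM fmorphV !rmorphXn.
Qed.
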